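(* Let $1\le k\le n$, let $A\in\mathbb{R}^{n\times n}$ be symmetric and nonsingular, and let $J\in\mathbb{R}^{k\times k}$ be symmetric with $J^2=I_k$. Let $X\mapsto \mathbf{M}_X$ be a map assigning to each $X\in\mathrm{iSt}_{A,J}(k,n)$ a symmetric positive-definite matrix $\mathbf{M}_X\in\mathbb{R}^{n\times n}$ depending smoothly on $X$. Then for every $X\in\mathrm{iSt}_{A,J}(k,n)$, the normal space to $\mathrm{iSt}_{A,J}(k,n)$ at $X$ with respect to $\mathrm{g}_{\mathbf{M}_X}$ is $$T_X\mathrm{iSt}_{A,J}(k,n)^{\perp}_{\mathrm{g}_{\mathbf{M}_X}}=\{\mathbf{M}_X^{-1}AXW : W\in\mathrm{Sym}(k)\}.$$
   Context: $\mathrm{iSt}_{A,J}(k,n)=\{X\in\mathbb{R}^{n\times k} : X^TAX=J\}$ is the indefinite Stiefel manifold, an embedded submanifold of $\mathbb{R}^{n\times k}$ whenever nonempty, with tangent space $T_X\mathrm{iSt}_{A,J}(k,n)=\{Z\in\mathbb{R}^{n\times k}: Z^TAX+X^TAZ=0\}$. The inner product $\mathrm{g}_{\mathbf{M}_X}$ is defined by $\mathrm{g}_{\mathbf{M}_X}(Z_1,Z_2)=\mathrm{tr}(Z_1^T\mathbf{M}_XZ_2)$ for $Z_1,Z_2\in T_X\mathrm{iSt}_{A,J}(k,n)$, and by the same formula for $Z_1,Z_2\in\mathbb{R}^{n\times k}$. The normal space is $$T_X\mathrm{iSt}_{A,J}(k,n)^{\perp}_{\mathrm{g}_{\mathbf{M}_X}}=\{N\in\mathbb{R}^{n\times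 k} : \mathrm{g}_{\mathbf{M}_X}(N,Z)=0\ \text{for all } Z\in T_X\mathrm{iSt}_{A,J}(k,n)\}.$$ $\mathrm{Sym}(k)$ denotes the set of real symmetric $k\times k$ matrices. *)

(* Defs.v *)
From HB Require Import structures.
From mathcomp Require Import all_boot all_order all_algebra.
From mathcomp Require Import all_classical all_reals all_analysis.

Set Implicit Arguments.
Unset Strict Implicit.
Unset Printing Implicit Defensive.

Import Order.TTheory GRing.Theory Num.Theory.
Import numFieldNormedType.Exports.

Local Open Scope classical_set_scope.
Local Open Scope ring_scope.

Definition Sym (R : realType) (k : nat) : set 'M[R]_k :=
  [set W | W \is symmetricmx].
Arguments Sym : clear implicits.

Definition sym_posdef (R : realType) (n : nat) (P : 'M[R]_n) : Prop :=
  P \is symmetricmx /\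
  forall v : 'cV[R]_n, v != 0 -> 0 < (v^T *m P *m v) 0 0.

Definition iSt (R : realType) (k n : nat) (A : 'M[R]_n) (J : 'M[R]_k) :
    set 'M[R]_(n, k) :=
  [set X | X^T *m A *m X = J].

Definition tangent_iSt (R : realType) (k n : nat) (A : 'M[R]_n)
    (X : 'M[R]_(n, k)) : set 'M[R]_(n, k) :=
  [set Z | Z^T *m A *m X + X^T *m A *m Z = 0].

Definition metric (R : realType) (k n : nat) (P : 'M[R]_n)
    (Z1 Z2 : 'M[R]_(n, k)) : R :=
  \tr (Z1^T *m P *m Z2).

Definition normal_iSt (R : realType) (k n : nat) (A P : 'M[R]_n)
    (X : 'M[R]_(n, k)) : set 'M[R]_(n, k) :=
  [set N | forall Z, tangent_iSt A X Z -> metric P N Z = 0].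

(* Meant for an open set U.  Since the spaces of matrices are finite
   dimensional, asking that x |-> 'd f x v be of class C^r for every fixed v
   is the same as asking that x |-> 'd f x be of class C^r. *)
Fixpoint Cn_on (R : realType) (m n p q : nat) (r : nat)
    (U : set 'M[R]_(m, n)) (f : 'M[R]_(m, n) -> 'M[R]_(p, q)) : Prop :=
  match r with
  | 0 => forall x, U x -> {for x, continuous f}
  | r'.+1 => (forall x, U x -> differentiable f x) /\
             (forall v : 'M[R]_(m, n), Cn_on r' U (fun x => 'd f x v))
  end.

(* Smoothness of the restriction of f to a subset S which is an embedded
   submanifold: near each point of S, f agrees on S with a map that is
   C^infinity on an open set of the ambient space.  The values of f outside S
   are irrelevant. *)
Definition smooth_along (R : realType) (m n p q : nat)
    (S : set 'M[R]_(m, n)) (f : 'M[R]_(m, n) -> 'M[R]_(p, q)) : Prop :=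
  forall x, S x ->
    exists (U : set 'M[R]_(m, n)) (F : 'M[R]_(m, n) -> 'M[R]_(p, q)),
      [/\ open U, U x, forall r, Cn_on r U F
        & forall y, U y -> S y -> F y = f y].

(* Main.v *)
(** Put Y = A X, so that Y^T X = J and J J = 1.  For every Z, the matrix
    Z - X J Y^T Z is tangent, since Y^T kills it; orthogonality of Q = M_X N
    to all of these forces Q = Y W with W = J X^T Q.  For every
    skew-symmetric S, X J S is tangent, and orthogonality of Q to these makes
    W orthogonal to all skew-symmetric matrices, in particular to W - W^T;
    hence W is symmetric. *)
Require Import Defs.
From HB Require Import structures.
From mathcomp Require Import all_boot all_order all_algebra.
From mathcomp Require Import all_classical all_reals all_analysis.

Import Order.TTheory GRing.Theory Num.Theory.
Import numFieldNormedType.Exports.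

Local Open Scope classical_set_scope.
Local Open Scope ring_scope.

(** The trace is the sum of the squares of all entries of [B]. *)
Lemma mxtrace_trmul_eq0 (R : realDomainType) (m n : nat) (B : 'M[R]_(m, n)) :
  \tr (B^T *m B) = 0 -> B = 0.
Proof.
move=> /eqP; rewrite /mxtrace psumr_eq0 => [|j _]; last first.
  by rewrite mxE sumr_ge0 // => i _; rewrite mxE -expr2 sqr_ge0.
move=> /allP B0; apply/matrixP => i j; rewrite [RHS]mxE.
have /= := B0 j (mem_index_enum j); rewrite mxE psumr_eq0 => [|l _].
  move=> /allP /(_ i (mem_index_enum i)) /=.
  by rewrite mxE -expr2 sqrf_eq0 => /eqP.
by rewrite mxE -expr2 sqr_ge0.
Qed.

Lemma symmetricmxP (R : fieldType) (k : nat) (W : 'M[R]_k) :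
  reflect (W = W^T) (W \is symmetricmx).
Proof. by rewrite is_hermitianmxE expr0 scale1r map_mx_id //; apply: eqP. Qed.

Lemma mxtrace_trmul_skew_sym (R : realFieldType) (k : nat) (W : 'M[R]_k) :
  (forall S : 'M[R]_k, S^T = - S -> \tr (W^T *m S) = 0) ->
  W \is symmetricmx.
Proof.
move=> W_orth; set S := W - W^T.
have S_skew : S^T = - S by rewrite /S linearB /= trmxK opprB.
have S0 : S = 0.
  apply: mxtrace_trmul_eq0.
  have {1}-> : S^T = W^T - W by rewrite S_skew opprB.
  rewrite mulmxBl linearB /= W_orth // sub0r.
  (* Transposing and using that [S] is skew, [\tr (W *m S)] equals [- \tr (W^T *m S)]. *)
  rewrite -mxtrace_tr trmx_mul S_skew mulNmx linearN /= opprK mxtrace_mulC.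
  exact: W_orth.
by apply/symmetricmxP; apply/eqP; rewrite -subr_eq0; apply/eqP.
Qed.

Lemma sym_posdef_unitmx (R : realType) (n : nat) (P : 'M[R]_n) :
  sym_posdef P -> P \in unitmx.
Proof.
move=> [_ P_pos]; rewrite unitmxE unitfE; apply/negP => /det0P [v v0 vP0].
have := P_pos v^T; rewrite trmx_eq0 trmxK vP0 mul0mx mxE ltxx.
by move=> /(_ v0).
Qed.

Theorem proposition3p1 (R : realType) (k n : nat)
    (hk : (1 <= k)%N) (hkn : (k <= n)%N)
    (A : 'M[R]_n) (hAsym : A \is symmetricmx) (hAunit : A \in unitmx)
    (J : 'M[R]_k) (hJsym : J \is symmetricmx) (hJ2 : J *m J = 1%:M)
    (M : 'M[R]_(n, k) -> 'M[R]_n)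
    (hMpos : forall X, iSt A J X -> sym_posdef (M X))
    (hMsmooth : smooth_along (iSt A J) M) :
  forall X : 'M[R]_(n, k), iSt A J X ->
    normal_iSt A (M X) X =
    [set invmx (M X) *m A *m X *m W | W in Sym R k].
Proof.
move=> X XJ; have P_unit := sym_posdef_unitmx _ _ _ (hMpos X XJ).
have [/symmetricmxP P_sym _] := hMpos X XJ.
move: (M X) P_unit P_sym => P P_unit P_sym.
move: hAsym hJsym => /symmetricmxP A_sym /symmetricmxP J_sym.
have XAX : X^T *m A *m X = J := XJ.
apply/seteqP; split=> [N N_normal|_ [W /symmetricmxP W_sym <-] Z Z_tan].
- pose Q := P *m N.
  have NE : N = invmx P *m Q by rewrite mulKmx.
  have Q_orth Z : tangent_iSt A X Z -> \tr (Q^T *m Z) = 0.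
    by move=> /N_normal; rewrite /metric /Q trmx_mul -P_sym.
  (* If [Q = A *m X *m W], multiplying by [X^T] gives [X^T *m Q = J *m W], and [J *m J = 1] leaves
     only this choice of [W]. *)
  move: Q NE Q_orth => Q NE Q_orth; pose W := J *m X^T *m Q.
  (* As [A] is symmetric, [Z^T *m A *m X] is the transpose of [X^T *m A *m Z]. *)
  have tangentI Z : (X^T *m A *m Z)^T = - (X^T *m A *m Z) -> tangent_iSt A X Z.
    move=> skew; rewrite /tangent_iSt /= -[Y in _ + Y]opprK -skew.
    by rewrite !trmx_mul trmxK -A_sym mulmxA subrr.
  have QE : Q = A *m X *m W.
    apply/eqP; rewrite -subr_eq0; apply/eqP; apply: mxtrace_trmul_eq0.
    set D := Q - _.
    (* The transpose of [A *m X *m W] is [Q^T *m X *m J *m X^T *m A]; moving this factor onto [D]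
       pairs [Q] with a tangent vector. *)
    have -> : D^T *m D = Q^T *m (D - X *m J *m (X^T *m A *m D)).
      have -> : D^T = Q^T - (A *m X *m W)^T by rewrite linearB.
      rewrite mulmxBl [RHS]mulmxBr; congr (_ - _).
      by rewrite /W !trmx_mul trmxK -J_sym -A_sym !mulmxA.
    apply/Q_orth/tangentI; rewrite mulmxBr !mulmxA XAX hJ2 mul1mx subrr.
    by rewrite trmx0 oppr0.
  exists W; last by rewrite NE QE !mulmxA.
  (* Here [W^T *m S = Q^T *m (X *m J *m S)], and [X^T *m A] sends [X *m J *m S] to the skew [S]. *)
  apply: (mxtrace_trmul_skew_sym _ _ W) => S S_skew.
  rewrite /W !trmx_mul trmxK -J_sym -!mulmxA.
  by apply/Q_orth/tangentI; rewrite !mulmxA XAX hJ2 mul1mx.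
(* Conversely, the metric reduces to the trace of the symmetric [W] times the skew [X^T *m A *m Z];
   transposition shows that this trace is its own opposite. *)
- have -> : metric P (invmx P *m A *m X *m W) Z = \tr (W *m (X^T *m A *m Z)).
    rewrite /metric !trmx_mul trmx_inv -P_sym -A_sym -W_sym !mulmxA.
    by rewrite mulmxKV.
  have trE : \tr (W *m (Z^T *m A *m X)) = \tr (W *m (X^T *m A *m Z)).
    rewrite -mxtrace_tr !trmx_mul trmxK -A_sym -W_sym mxtrace_mulC.
    by rewrite !mulmxA.
  have /eqP : \tr (W *m (X^T *m A *m Z)) *+ 2 = 0.
    by rewrite mulr2n -{1}trE -linearD /= -mulmxDr Z_tan mulmx0 linear0.
  by rewrite mulrn_eq0 => /eqP.
Qed.
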